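(* Consider the system $\dot x(t)=Ax(t)+B(u(t)+d(t))$ under the event-triggered sliding mode control law $$u(t)=-(c^TB)^{-1}\big(c^TAx(t_i)+K(x(t_i))\,\mathrm{sign}\,s(t_i)\big),\qquad t\in[t_i,t_{i+1}),\ i\in\mathbb N,$$ where the triggering instants are generated by $t_{i+1}=\min(t'_{i+1},t''_{i+1})$ with $$t'_{i+1}=\inf\Big\{t>t_i:\ \frac{x^T(t)\,x(t_i)}{\|x(t)\|\,\|x(t_i)\|}\le\cos\frac{\theta}{2N}\Big\},\qquad t''_{i+1}=\inf\big\{t>t_i:\ |c^TAe(t)|\ge\sigma\|x(t_i)\|+\beta\big\}.$$ Then, with no a priori bound on the size of the state, there exists a unified minimum positive inter-event time $T_i=\min(T_{i1},T_{i2})$, $i\in\mathbb N$, where $T_{i1}$ and $T_{i2}$ (the inter-event times generated by the first and the second rule, respectively) satisfy $$T_{i1}\ge\frac1{\|A\|}\ln\left(1+\frac{\sin\frac{\theta}{2N}}{\rho}\|A\|-\frac{\sin\frac{\theta}{2N}\,\frac{\gamma}{\rho}\|A\|}{\rho\|x(t_i)\|+\gamma}\right),\qquad T_{i2}\ge\frac1{\|A\|}\ln\left(1+\frac{\sigma\|x(t_i)\|+\beta}{\|c\|\,(\rho\|x(t_i)\|+\gamma)}\right),$$ with $$\rho=\|A-B(c^TB)^{-1}c^TA\|,\qquad \gamma=\|B(c^TB)^{-1}\|\,\|K(x(t_i))\|+\|B\|\,d_{\max}.$$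
   Context: The system is a linear time-invariant system $\dot{\tilde x}=\tilde A\tilde x+\tilde B(u+d)$ with $(\tilde A,\tilde B)$ controllable, brought to regular form by a nonsingular linear change of coordinates: $x=(x_1^T,x_2)^T\in\mathbb R^n$, $x_1\in\mathbb R^{n-1}$, $x_2\in\mathbb R$, $A=\begin{bmatrix}A_{11}&A_{12}\\ A_{21}&A_{22}\end{bmatrix}\in\mathbb R^{n\times n}$, $B=[0,\dots,0,1]^T\in\mathbb R^{n\times1}$; $u(t)\in\mathbb R$ is the control and $d(t)\in\mathbb R$ is a disturbance with $\sup_{t\ge t_0}|d(t)|\le d_{\max}$, $d_{\max}>0$ a known constant. The initial time is $t_0$. Sliding variables: $s=c^Tx$, $\hat s=\hat c^Tx$, $\check s=\check c^Tx$ with $c=(c_1^T,1)^T$, $\hat c=(\hat c_1^T,1)^T$, $\check c=(\check c_1^T,1)^T\in\mathbb R^n$, where $c_1,\hat c_1,\check c_1\in\mathbb R^{n-1}$ are chosen such that $A_{11}-A_{12}c_1^T$, $A_{11}-A_{12}\hat c_1^T$, $A_{11}-A_{12}\check c_1^T$ are all Hurwitz, and the sliding manifolds $\hat S=\{\hat c^Tx=0\}$ and $\check S=\{\check c^Tx=0\}$ lie on either side of $S=\{c^Tx=0\}$. The angle between $\hat S$ and $\check S$ is defined as $\theta=\pi-\arccos\big(\frac{\check c^T\cdot\hat c}{\|\hat c\|\,\|\check c\|}\big)$. The error state is $e(t)=x(t_i)-x(t)$ for $t\in[t_i,t_{i+1})$. The constants $\sigma,\beta$ are positive; $N\in\mathbb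 Z_+$ is a design parameter (unrelated to the state dimension $n$); $K(x(t_i))$ is a state-dependent control gain. $\|\cdot\|$ is the Euclidean norm for vectors and the induced 2-norm for matrices. Solutions are understood in the sense of Filippov. The inter-event time is $T_i=t_{i+1}-t_i$. *)

(* Defs.v *)
From HB Require Import structures.
From mathcomp Require Import all_boot all_order all_algebra.
From mathcomp Require Import complex.
From mathcomp Require Import all_classical all_reals all_analysis.
Import Order.TTheory GRing.Theory Num.Theory.
Import numFieldNormedType.Exports.

Set Implicit Arguments.
Unset Strict Implicit.
Unset Printing Implicit Defensive.

Local Open Scope classical_set_scope.
Local Open Scope ring_scope.

Definition dot {R : realType} {n : nat} (u v : 'cV[R]_n) : R :=
  (u^T *m v) 0 0.

(* The library norm on matrices is the sup norm, hence these two. *)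
Definition norm2 {R : realType} {n : nat} (v : 'cV[R]_n) : R :=
  Num.sqrt (dot v v).

Definition opnorm2 {R : realType} {m n : nat} (M : 'M[R]_(m, n)) : R :=
  sup [set norm2 (M *m v) | v in [set v : 'cV[R]_n | norm2 v <= 1]].

Definition hurwitz {R : realType} {n : nat} (M : 'M[R]_n) : Prop :=
  forall z : R[i], eigenvalue (map_mx (real_complex R) M) z -> complex.Re z < 0.

(* Lebesgue null sets of R^n, by countable covers with boxes of small total
   volume (the library has no Lebesgue measure on 'cV[R]_n). *)
Definition null_set {R : realType} {n : nat} (N : set 'cV[R]_n) : Prop :=
  forall eps : R, 0 < eps ->
  exists l u : nat -> 'cV[R]_n,
    [/\ forall k j, l k j 0 <= u k j 0,
        N `<=` \bigcup_k [set z | forall j, l k j 0 <= z j 0 <= u k j 0] &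
        (\sum_(0 <= k <oo) (\prod_j (u k j 0 - l k j 0))%:E <= eps%:E)%E].

(* Filippov's convexification: the intersection, over radii and null sets N,
   of the closed convex hull of g (B(z, delta) \ N); the hull is unfolded as
   the intersection of all closed convex sets containing that image. *)
Definition filippov_map {R : realType} {n : nat}
    (g : 'cV[R]_n -> 'cV[R]_n) (z : 'cV[R]_n) : set 'cV[R]_n :=
  [set w | forall (delta : R) (N : set 'cV[R]_n), 0 < delta -> null_set N ->
     forall C : set 'cV[R]_n, closed C -> convex_set C ->
       g @` ([set z' | norm2 (z' - z) < delta] `\` N) `<=` C -> C w].

(* x is absolutely continuous on [a, b] (it is the integral of an integrable
   function v) and its derivative v satisfies the inclusion almost
   everywhere. *)
Definition filippov_solution {R : realType} {n : nat}
    (g : R -> 'cV[R]_n -> 'cV[R]_n) (a b : R) (x : R -> 'cV[R]_n) : Prop :=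
  exists v : R -> 'cV[R]_n,
    [/\ forall j, (@lebesgue_measure R).-integrable `[a, b]
          (fun r => (v r j 0)%:E),
        {ae (@lebesgue_measure R), forall r,
          a <= r <= b -> filippov_map (g r) (x r) (v r)} &
        forall r, a <= r <= b -> forall j,
          x r j 0 = x a j 0 + \int[@lebesgue_measure R]_(q in `[a, r]) v q j 0].

Definition controllable {R : realType} {n : nat}
    (A : 'M[R]_n) (B : 'cV[R]_n) : Prop :=
  forall z0 z1 : 'cV[R]_n, exists (T : R) (u : R -> R) (x : R -> 'cV[R]_n),
    [/\ 0 < T, filippov_solution (fun r z => A *m z + u r *: B) 0 T x,
        x 0 = z0 & x T = z1].

Definition sliding_manifold {R : realType} {n : nat} (c : 'cV[R]_n) :
  set 'cV[R]_n := [set z | dot c z = 0].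

(* In the coordinates z = (z1, z2), z1 in R^m, the three manifolds are graphs
   over z1: above each z1 the points of the two outer ones are on opposite
   sides of the manifold of c (possibly touching it, since all the graphs
   meet at least at the origin), and neither outer one is that manifold.
   For m = 0 this is never satisfied. *)
Definition on_either_side {R : realType} {m : nat}
    (chat ccheck c : 'cV[R]_(m + 1)) : Prop :=
  [/\ sliding_manifold chat <> sliding_manifold c,
      sliding_manifold ccheck <> sliding_manifold c &
      forall zh zc, sliding_manifold chat zh -> sliding_manifold ccheck zc ->
        usubmx zh = usubmx zc -> dot c zh * dot c zc <= 0].

Definition manifold_angle {R : realType} {n : nat} (chat ccheck : 'cV[R]_n) : R :=
  pi - acos (dot ccheck chat / (norm2 chat * norm2 ccheck)).

Definition event_control {R : realType} {n : nat} (A : 'M[R]_n)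
    (B c : 'cV[R]_n) (K : 'cV[R]_n -> R) (xi : 'cV[R]_n) : R :=
  - (dot c B)^-1 * (dot c (A *m xi) + K xi * Num.sg (dot c xi)).

(* The infima are taken in the extended reals (inf of the empty set is +oo).
   The cosine in the first rule only makes sense for nonzero states; where it
   is undefined, the first rule does not fire. *)
Definition angle_event {R : realType} {n : nat} (theta : R) (N : nat)
    (ti : R) (y : R -> 'cV[R]_n) : \bar R :=
  ereal_inf [set r%:E | r in [set r : R |
    [/\ ti < r, y r != 0, y ti != 0 &
        dot (y r) (y ti) / (norm2 (y r) * norm2 (y ti))
          <= cos (theta / (2 * N%:R))]]].

Definition error_event {R : realType} {n : nat} (A : 'M[R]_n) (c : 'cV[R]_n)
    (sigma beta : R) (ti : R) (y : R -> 'cV[R]_n) : \bar R :=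
  ereal_inf [set r%:E | r in [set r : R |
    ti < r /\ sigma * norm2 (y ti) + beta <= `|dot c (A *m (y ti - y r))|]].

(* y i is the motion started at time t_i from x(t_i) with the control value
   of time t_i held; both rules are evaluated along it, and the state x
   follows it up to the next event.  This separates the two inter-event
   times: each of them is unaffected by the control update which the other
   rule may trigger first.  t i = +oo means that there is no i-th event. *)
Definition closed_loop {R : realType} {n : nat} (A : 'M[R]_n)
    (B c : 'cV[R]_n) (K : 'cV[R]_n -> R) (theta : R) (N : nat)
    (sigma beta : R) (t0 : R) (d : R -> R)
    (t : nat -> \bar R) (x : R -> 'cV[R]_n) (y : nat -> R -> 'cV[R]_n) : Prop :=
  [/\ t 0%N = t0%:E,
      forall i, t i = +oo%E -> t i.+1 = +oo%E &
      forall i, (t i < +oo)%E ->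
        let ti := fine (t i) in
        [/\ y i ti = x ti,
            forall b, ti <= b ->
              filippov_solution
                (fun r z => A *m z + (event_control A B c K (x ti) + d r) *: B)
                ti b (y i),
            t i.+1 = mine (angle_event theta N ti (y i))
                          (error_event A c sigma beta ti (y i)) &
            forall r, ti <= r -> (r%:E <= t i.+1)%E -> x r = y i r]].

Definition rho {R : realType} {n : nat} (A : 'M[R]_n) (B c : 'cV[R]_n) : R :=
  opnorm2 (A - (dot c B)^-1 *: (B *m (c^T *m A))).

Definition gamma {R : realType} {n : nat} (B c : 'cV[R]_n)
    (K : 'cV[R]_n -> R) (dmax : R) (xi : 'cV[R]_n) : R :=
  norm2 ((dot c B)^-1 *: B) * `|K xi| + norm2 B * dmax.

Definition angle_bound {R : realType} {n : nat} (A : 'M[R]_n)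
    (B c : 'cV[R]_n) (K : 'cV[R]_n -> R) (theta : R) (N : nat) (dmax : R)
    (xi : 'cV[R]_n) : R :=
  let s := sin (theta / (2 * N%:R)) in
  let rh := rho A B c in
  let ga := gamma B c K dmax xi in
  1 / opnorm2 A *
    ln (1 + s / rh * opnorm2 A
          - s * (ga / rh) * opnorm2 A / (rh * norm2 xi + ga)).

Definition error_bound {R : realType} {n : nat} (A : 'M[R]_n)
    (B c : 'cV[R]_n) (K : 'cV[R]_n -> R) (sigma beta dmax : R)
    (xi : 'cV[R]_n) : R :=
  1 / opnorm2 A *
    ln (1 + (sigma * norm2 xi + beta) /
            (norm2 c * (rho A B c * norm2 xi + gamma B c K dmax xi))).

(* Main.v *)
Require Import Defs.
From HB Require Import structures.
From mathcomp Require Import all_boot all_order all_algebra.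
From mathcomp Require Import complex.
From mathcomp Require Import all_classical all_reals all_analysis.
From mathcomp Require Import measurable_realfun ring lra.
Import Order.TTheory GRing.Theory Num.Theory.
Import numFieldNormedType.Exports.

(** Between two events the control is frozen, so the error [e = x(t_i) - x]
   starts at [0] and satisfies
     [e' = A e - (A - B (c^T B)^-1 c^T A) x(t_i)
           + (c^T B)^-1 K sign(s(t_i)) B - d B],
   whence [|e'| <= |A| |e| + L] almost everywhere, with
   [L = rho |x(t_i)| + gamma] ([held_field_bound]).  By the integral form of
   Gronwall's inequality ([gronwall], [filippov_deviation]), for every
   [k >= |A|] with [k > 0],
     [|e(r)| <= L / k * (exp (k (r - t_i)) - 1)]   ([held_deviation]).
   The held field is affine in the state, so its Filippov convexification is
   single valued and the differential inclusion is an ordinary equation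
   ([filippov_map_affine]).

   When a rule fires, [e] has already reached a definite size: at least
   [sin (theta / 2N) |x(t_i)|] for the angle rule ([norm2_sin_le]), at least
   [(sigma |x(t_i)| + beta) / (|c| k)] for the error rule.  Solving the
   exponential bound for [r - t_i] ([ln_le_time]) gives lower bounds on both
   inter-event times ([angle_event_ge], [error_event_ge]); with [k = |A|] they
   are the bounds of the theorem.

   For the uniform positive bound [tau] the same estimates are used with
   [k = |A| + 1], which stays positive when [A = 0].  The error rule always
   yields a positive time because [beta > 0].  The angle rule yields a positive
   time at nonzero states, because [0 < theta <= pi]: the normals of the two
   outer manifolds have last coordinate [1], so they are not opposite
   ([manifold_angle_bounds]).  At the origin the angle rule never fires. *)

Set Implicit Arguments.
Unset Strict Implicit.
Unset Printing Implicit Defensive.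

Local Open Scope classical_set_scope.
Local Open Scope ring_scope.

(** * Euclidean and operator norms *)

Section euclid.
Variables (R : realType) (n : nat).
Implicit Types (u v w : 'cV[R]_n) (k : R).

Lemma dotE u v : dot u v = \sum_j u j 0 * v j 0.
Proof. by rewrite /dot mxE; apply: eq_bigr => j _; rewrite mxE. Qed.

Lemma dotC u v : dot u v = dot v u.
Proof. by rewrite !dotE; apply: eq_bigr => j _; rewrite mulrC. Qed.

Lemma dotDr u v w : dot u (v + w) = dot u v + dot u w.
Proof. by rewrite /dot mulmxDr mxE. Qed.

Lemma dotZr u k v : dot u (k *: v) = k * dot u v.
Proof. by rewrite /dot -scalemxAr mxE. Qed.

Lemma dotBr u v w : dot u (v - w) = dot u v - dot u w.
Proof. by rewrite -scaleN1r dotDr dotZr mulN1r. Qed.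

Lemma dotDl u v w : dot (v + w) u = dot v u + dot w u.
Proof. by rewrite dotC dotDr !(dotC u). Qed.

Lemma dotBl u v w : dot (v - w) u = dot v u - dot w u.
Proof. by rewrite dotC dotBr !(dotC u). Qed.

Lemma dotZl u k v : dot (k *: v) u = k * dot v u.
Proof. by rewrite dotC dotZr (dotC u). Qed.

Lemma dot_ge0 u : 0 <= dot u u.
Proof. by rewrite dotE sumr_ge0// => j _; rewrite -expr2 sqr_ge0. Qed.

Lemma dot_eq0 u : dot u u = 0 -> u = 0.
Proof.
rewrite dotE => /psumr_eq0P u0; apply/colP => j; rewrite mxE.
by apply/eqP; rewrite -sqrf_eq0 expr2 u0// => i _; rewrite -expr2 sqr_ge0.
Qed.

Lemma norm2_ge0 u : 0 <= norm2 u.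
Proof. exact: sqrtr_ge0. Qed.

Lemma norm2_sqr u : norm2 u ^+ 2 = dot u u.
Proof. by rewrite sqr_sqrtr// dot_ge0. Qed.

Lemma norm2_gt0 u : u != 0 -> 0 < norm2 u.
Proof.
move=> u0; rewrite lt_def norm2_ge0 andbT; apply: contra u0 => /eqP nu0.
by apply/eqP/dot_eq0; rewrite -norm2_sqr nu0 expr0n.
Qed.

Lemma norm20 : norm2 (0 : 'cV[R]_n) = 0.
Proof. by rewrite /norm2 /dot mulmx0 mxE sqrtr0. Qed.

Lemma norm2Z k u : norm2 (k *: u) = `|k| * norm2 u.
Proof. by rewrite /norm2 dotZl dotZr mulrA -expr2 sqrtrM ?sqr_ge0// sqrtr_sqr. Qed.

Lemma norm2N u : norm2 (- u) = norm2 u.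
Proof. by rewrite -scaleN1r norm2Z normrN1 mul1r. Qed.

Lemma dot_le_norm2 u v : `|dot u v| <= norm2 u * norm2 v.
Proof.
have [->|v0] := eqVneq v 0; first by rewrite norm20 mulr0 /dot mulmx0 mxE normr0.
rewrite -ler_sqr ?nnegrE ?mulr_ge0 ?norm2_ge0// real_normK ?num_real// exprMn !norm2_sqr.
have vv : 0 < dot v v by rewrite -norm2_sqr exprn_gt0// norm2_gt0.
(* [dot v v] times the component of [u] orthogonal to [v] *)
have := dot_ge0 (dot v v *: u - dot u v *: v).
rewrite dotBr !dotBl !dotZr !dotZl (dotC v u).
rewrite (_ : _ - _ = dot v v * (dot u u * dot v v - dot u v ^+ 2)); last by ring.
by rewrite pmulr_rge0// subr_ge0.
Qed.

Lemma norm2D u v : norm2 (u + v) <= norm2 u + norm2 v.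
Proof.
rewrite -ler_sqr ?nnegrE ?addr_ge0 ?norm2_ge0// sqrrD !norm2_sqr dotDr !dotDl.
have := le_trans (ler_norm _) (dot_le_norm2 u v); rewrite (dotC v u); lra.
Qed.

Lemma coord_le_norm2 u j : `|u j 0| <= norm2 u.
Proof.
rewrite -ler_sqr ?nnegrE ?norm2_ge0// real_normK ?num_real// norm2_sqr dotE (bigD1 j)//=.
by rewrite -expr2 lerDl sumr_ge0// => i _; rewrite -expr2 sqr_ge0.
Qed.

End euclid.

Section opnorm.
Variables (R : realType) (m n : nat) (M : 'M[R]_(m, n)).

(** The Frobenius norm is an upper bound; without one, the supremum defining
   [opnorm2] would carry no information. *)
Lemma opnorm2_has_sup :
  has_sup [set norm2 (M *m v) | v in [set v : 'cV[R]_n | norm2 v <= 1]].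
Proof.
split; first by exists (norm2 (M *m 0)), 0 => //=; rewrite norm20.
(* the Frobenius norm of [M] *)
exists (Num.sqrt (\sum_i norm2 (row i M)^T ^+ 2)) => _ [v /= v1 <-].
apply: ler_wsqrtr; rewrite dotE ler_sum// => i _.
rewrite -expr2 (_ : (M *m v) i 0 = dot (row i M)^T v); last first.
  by rewrite /dot trmxK -row_mul [RHS]mxE.
rewrite -real_normK ?num_real// ler_sqr ?nnegrE ?norm2_ge0// (le_trans (dot_le_norm2 _ _))//.
by rewrite ler_piMr// norm2_ge0.
Qed.

Lemma opnorm2_ge0 : 0 <= opnorm2 M.
Proof.
apply: (le_trans (norm2_ge0 (M *m 0))).
by apply: ub_le_sup; [case: opnorm2_has_sup|exists 0 => //=; rewrite norm20].
Qed.

Lemma norm2_mulmx (v : 'cV[R]_n) : norm2 (M *m v) <= opnorm2 M * norm2 v.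
Proof.
have [->|v0] := eqVneq v 0; first by rewrite mulmx0 !norm20 mulr0.
have nv := norm2_gt0 v0.
rewrite -ler_pdivrMr// mulrC -[X in X * _]ger0_norm ?invr_ge0 ?norm2_ge0//.
rewrite -norm2Z scalemxAr; apply: ub_le_sup; first by case: opnorm2_has_sup.
exists ((norm2 v)^-1 *: v) => //=.
by rewrite norm2Z ger0_norm ?invr_ge0 ?norm2_ge0// mulVf// gt_eqF.
Qed.

End opnorm.

(** * Angles *)

(** If the angle between [u] and [v] has cosine at most [cos phi], then
   [|v - u|^2 >= (|u| - |v| cos phi)^2 + (|v| sin phi)^2] by the law of
   cosines. *)
Lemma norm2_sin_le (R : realType) (n : nat) (u v : 'cV[R]_n) (phi : R) :
  u != 0 -> v != 0 ->
  dot u v / (norm2 u * norm2 v) <= cos phi -> norm2 v * sin phi <= norm2 (v - u).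
Proof.
move=> /norm2_gt0 u0 /norm2_gt0 v0; rewrite ler_pdivrMr ?mulr_gt0// => uv.
apply: le_trans (ler_norm _) _.
rewrite -ler_sqr ?nnegrE ?norm2_ge0// real_normK ?num_real// norm2_sqr dotBr !dotBl.
rewrite (dotC v u) -!norm2_sqr exprMn.
have -> : sin phi ^+ 2 = 1 - cos phi ^+ 2 by rewrite -(cos2Dsin2 phi); ring.
have := sqr_ge0 (norm2 u - norm2 v * cos phi); nra.
Qed.

(** The angle vanishes only for opposite normals, which the common last
   coordinate [1] forbids. *)
Lemma manifold_angle_bounds (R : realType) (m : nat) (a b : 'cV[R]_m) :
  0 < manifold_angle (col_mx a 1%:M : 'cV[R]_(m + 1)) (col_mx b 1%:M) <= pi.
Proof.
rewrite /manifold_angle.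
set u := col_mx a _; set v := col_mx b _.
have u1 : u (rshift m 0) 0 = 1 by rewrite col_mxEd mxE.
have v1 : v (rshift m 0) 0 = 1 by rewrite col_mxEd mxE.
clearbody u v.
have nu : 0 < norm2 u.
  by apply: lt_le_trans (coord_le_norm2 u (rshift m 0)); rewrite u1 normr1.
have nv : 0 < norm2 v.
  by apply: lt_le_trans (coord_le_norm2 v (rshift m 0)); rewrite v1 normr1.
have := dot_le_norm2 v u; rewrite ler_norml => /andP[lo hi].
have lo' : -1 < dot v u / (norm2 u * norm2 v).
  rewrite ltr_pdivlMr ?mulr_gt0// mulN1r lt_neqAle mulrC lo andbT.
  apply/eqP => vu.
  have : norm2 v *: u + norm2 u *: v = 0.
    (* equality case of Cauchy-Schwarz *)
    apply: dot_eq0; rewrite dotDr !dotDl !dotZr !dotZl (dotC u v) -!norm2_sqr.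
    by rewrite -vu; ring.
  move=> /colP/(_ (rshift m 0)); rewrite !mxE u1 v1; lra.
have hi' : dot v u / (norm2 u * norm2 v) <= 1.
  by rewrite ler_pdivrMr ?mulr_gt0// mul1r mulrC.
by rewrite subr_gt0 acos_ltpi ?lo'//= lerBlDl lerDr acos_ge0// (ltW lo').
Qed.

(** * The Filippov map of an affine field *)

(** In dimension [0] the empty product makes every box of volume [1], hence the
   positive dimension. *)
Lemma null_set_empty (R : realType) (n : nat) : Defs.null_set (set0 : set 'cV[R]_n.+1).
Proof.
move=> eps eps0; exists (fun=> 0), (fun=> 0); split => //.
rewrite eseries0 ?lee_fin ?ltW// => k _ _.
by rewrite big_ord_recl /= !mxE subrr mul0r.
Qed.

Lemma closed_box (R : realType) (n : nat) (c : 'cV[R]_n) (eps : R) :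
  closed [set w : 'cV[R]_n | forall j, `|w j 0 - c j 0| <= eps].
Proof.
rewrite (_ : mkset _ = \bigcap_j [set w : 'cV[R]_n | `|w j 0 - c j 0| <= eps]);
  last by apply/seteqP; split => w /= h j; [move=> _|]; exact: h.
apply: closed_bigI => j _.
have cj : continuous (fun w : 'cV[R]_n => `|w j 0 - c j 0|).
  move=> w.
  apply: (@continuous_comp _ _ _ (fun w : 'cV[R]_n => w j 0)
    (fun t : R => `|t - c j 0|)); first exact: coord_continuous.
  by apply: cvg_norm; apply: cvgB; [exact: cvg_id|exact: cvg_cst].
exact: (preimage_closed (fun w _ => cj w) (@closed_le R eps)).
Qed.

Lemma convex_box (R : realType) (n : nat) (c : 'cV[R]_n) (eps : R) :
  convex_set [set w : 'cV[R]_n | forall j, `|w j 0 - c j 0| <= eps].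
Proof.
move=> x y k /set_mem /= hx /set_mem /= hy; apply/mem_set => j /=.
have k0 : 0 <= k%:num by [].
have k1 : k%:num <= 1 by [].
move: (hx j) (hy j); rewrite !mxE !ler_norml /= => /andP[x1 x2] /andP[y1 y2].
rewrite /unstable.onem; move: (k%:num) k0 k1 => a a0 a1.
by apply/andP; split; nra.
Qed.

(** By continuity, small balls are mapped into small closed boxes around the
   value at [z]; these boxes are closed and convex, so every Filippov value
   lies in all of them. *)
Lemma filippov_map_affine (R : realType) (n : nat) (A : 'M[R]_n)
    (b z w : 'cV[R]_n) :
  filippov_map (fun z => A *m z + b) z w -> w = A *m z + b.
Proof.
case: n A b z w => [|n] A b z w fw; first by apply/colP => -[].
have box (eps : R) : 0 < eps ->
    forall j, `|w j 0 - (A *m z + b) j 0| <= eps.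
  move=> eps0.
  have d0 : 0 < eps / (opnorm2 A + 1).
    by rewrite divr_gt0// ltr_wpDl// opnorm2_ge0.
  apply: (fw _ _ d0 (@null_set_empty R n) _ (@closed_box R n.+1 (A *m z + b) eps)
    (@convex_box R n.+1 (A *m z + b) eps)).
  move=> _ [z' /= [/ltW zz' _] <-] j.
  rewrite (_ : _ - _ = (A *m (z' - z)) j 0); last by rewrite mulmxBr !mxE; ring.
  apply: le_trans (coord_le_norm2 _ _) _.
  apply: le_trans (norm2_mulmx _ _) _.
  apply: le_trans (ler_wpM2l (opnorm2_ge0 _) zz') _.
  rewrite mulrA ler_pdivrMr ?ltr_wpDl ?opnorm2_ge0// mulrC ler_wpM2l ?(ltW eps0)//.
  lra.
apply/colP => j; apply/eqP; rewrite -subr_eq0 -normr_eq0; apply/eqP/le_anti.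
rewrite normr_ge0 andbT; apply/ler_addgt0Pl => e e0; rewrite addr0; exact: box.
Qed.

(** * Integral inequalities *)

(** [g - f] and [|g - f|] agree almost everywhere and the integral of the
   latter is nonnegative; this avoids altering [f] on a null set. *)
Lemma ae_le_Rintegral d (T : measurableType d) (R : realType)
    (mu : {measure set T -> \bar R}) (D : set T) (f g : T -> R) :
  measurable D -> mu.-integrable D (EFin \o f) -> mu.-integrable D (EFin \o g) ->
  {ae mu, forall x, D x -> f x <= g x} ->
  \int[mu]_(x in D) f x <= \int[mu]_(x in D) g x.
Proof.
move=> mD intf intg fg; rewrite -subr_ge0 -RintegralB//.
have mgf : measurable_fun D (g \- f).
  by apply: measurable_funB; apply/measurable_EFinP; apply: measurable_int;
    eassumption.
rewrite /Rintegral (@ae_eq_integral _ _ _ mu D (fun x => `|g x - f x|%:E)) //.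
- by apply: fine_ge0; apply: integral_ge0 => x _; rewrite lee_fin.
- exact/measurable_EFinP.
- by apply/measurable_EFinP; apply: measurableT_comp.
- by apply: filterS fg => x fg Dx; rewrite ger0_norm// subr_ge0 fg.
Qed.

(** With [F] the integral on the right-hand side, [(F + L / k) exp (- k r)] has
   derivative [k (f - F) exp (- k r) <= 0], so it is nonincreasing; it equals
   [L / k exp (- k a)] at [a]. *)
Lemma gronwall (R : realType) (f : R -> R) (a b k L : R) :
  0 < k -> a <= b -> {within `[a, b], continuous f} ->
  (forall r, a <= r <= b ->
     f r <= \int[@lebesgue_measure R]_(q in `[a, r]) (k * f q + L)) ->
  f b <= L / k * (expR (k * (b - a)) - 1).
Proof.
move=> k0; rewrite le_eqVlt => /predU1P[<- _|ab cf] fle.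
  have := fle a; rewrite lexx subrr mulr0 expR0 subrr mulr0 set_itv1.
  by rewrite Rintegral_set1; apply.
pose h q := k * f q + L.
have ch : {within `[a, b], continuous h}.
  move=> x; apply: cvgD; last exact: cvg_cst.
  by apply: cvgM; [exact: cvg_cst|exact: cf].
have ih : (@lebesgue_measure R).-integrable `[a, b] (EFin \o h).
  by apply: continuous_compact_integrable => //; exact: segment_compact.
pose F r := \int[@lebesgue_measure R]_(q in `[a, r]) h q.
pose E : R -> R := expR \o ((- k) \*: id).
have dE (x : R) : is_derive x 1 E (- k * E x).
  have dk : is_derive x 1 ((- k) \*: id : R -> R) (- k *: 1).
    exact: is_deriveZ.
  by apply: is_derive_eq; rewrite mulrC /GRing.scale /= mulr1.
pose G : R -> R := (F + cst (L / k)) * E.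
have dG x : x \in `]a, b[ -> is_derive x 1 G (k * (f x - F x) * E x).
  move=> xab; have := xab; rewrite in_itv/= => /andP[ax xb].
  have hx : {for x, continuous h}.
    by have [/(_ _ xab) + _ _] := (continuous_within_itvP _ ab).1 ch.
  have [dF F'] := continuous_FTC1_closed xb ih ax hx.
  have {}dF : is_derive x 1 F (h x).
    by apply: DeriveDef => //; rewrite -derive1E.
  have dFL : is_derive x 1 (F + cst (L / k)) (h x + 0) by exact: is_deriveD.
  apply: (@is_derive_eq _ _ _ _ _ _ _ _ (is_deriveM dFL (dE x))).
  rewrite /GRing.scale /= /h.
  rewrite (_ : (F + cst (L / k)) x = F x + L / k)//.
  by field; rewrite gt_eqF.
have cG : {within `[a, b], continuous G}.
  have cF := parameterized_integral_continuous (ltW ab) ih.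
  move=> x; apply: cvgM.
    by apply: cvgD; [exact: cF|exact: cvg_cst].
  apply: continuous_subspaceT => {}x; apply: differentiable_continuous.
  by apply/derivable1_diffP; case: (dE x).
have := @ler0_derive1_nincr _ G a b _ _ cG a b (lexx _) (ltW ab) (lexx _).
have Ga : G a = L / k * E a.
  by rewrite /G /= [LHS]/GRing.mul /= [X in X * _]/GRing.add /= /F set_itv1 Rintegral_set1 add0r.
have Gb : G b = (F b + L / k) * E b by [].
rewrite Ga Gb => H.
have {H} : (F b + L / k) * E b <= L / k * E a.
  apply: H => x xab; first by case: (dG x xab).
  have [_ G'] := dG _ xab; rewrite derive1E G' mulr_le0_ge0 ?expR_ge0//.
  rewrite pmulr_rle0// subr_le0; apply: fle.
  by move: xab; rewrite in_itv/= => /andP[/ltW-> /ltW->].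
have Eb : 0 < E b by exact: expR_gt0.
rewrite -ler_pdivlMr// -[_ * E a / E b]mulrA /E /= -expRN -expRD.
have -> : - k *: a - (- k *: b) = k * (b - a) by rewrite /GRing.scale /=; ring.
move=> H; apply: le_trans (fle b _) _; first by rewrite (ltW ab) lexx.
by move: H; rewrite -/h -/(F b); lra.
Qed.

Lemma Rintegral_dot d (T : measurableType d) (R : realType) (n : nat)
    (mu : {measure set T -> \bar R}) (D : set T) (w : 'cV[R]_n)
    (v : T -> 'cV[R]_n) :
  measurable D -> (forall j, mu.-integrable D (fun q => (v q j 0)%:E)) ->
  mu.-integrable D (EFin \o (fun q => dot w (v q))) /\
  \int[mu]_(q in D) dot w (v q) = \sum_j w j 0 * \int[mu]_(q in D) v q j 0.
Proof.
move=> mD iv.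
have ivj j : mu.-integrable D (fun q => (w j 0 * v q j 0)%:E).
  by under eq_fun do rewrite EFinM; exact: integrableZl.
have dE : EFin \o (fun q => dot w (v q)) = (fun q => \sum_j (w j 0 * v q j 0)%:E)%E.
  by apply/funext => q /=; rewrite dotE sumEFin.
split; first by rewrite dE; exact: integrable_sum.
rewrite /Rintegral -[X in fine X]/(\int[mu]_(q in D) (EFin \o (fun q => dot w (v q))) q)%E.
rewrite dE integral_sum// -sum_fine; last first.
  by move=> j _; exact: integrable_fin_num.
apply: eq_bigr => j _; rewrite -[RHS]RintegralZl//.
exact: iv.
Qed.

(** The increment [w] of the trajectory satisfies
   [|w|^2 = w . w = int (w . x') <= |w| int |x'|]: pairing with the fixed vector
   [w] gives the bound of the norm of a vector-valued integral from scalar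
   integrals only, and Gronwall's inequality then applies to the distance
   to the initial point. *)
Lemma filippov_deviation (R : realType) (n : nat) (g : R -> 'cV[R]_n -> 'cV[R]_n)
    (a b k L : R) (x : R -> 'cV[R]_n) :
  0 < k -> 0 <= L -> a <= b -> filippov_solution g a b x ->
  (forall r w, a <= r <= b -> filippov_map (g r) (x r) w ->
     norm2 w <= k * norm2 (x a - x r) + L) ->
  norm2 (x a - x b) <= L / k * (expR (k * (b - a)) - 1).
Proof.
move=> k0 L0 ab [v [iv vg xE]] vb.
pose f q := norm2 (x a - x q).
have cx j : {within `[a, b], continuous (fun r => x a j 0 - x r j 0)}.
  have cF := parameterized_integral_continuous ab (iv j).
  have : {within `[a, b], continuous
      (fun r => - \int[@lebesgue_measure R]_(q in `[a, r]) v q j 0)}.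
    by move=> r; apply: cvgN; exact: cF.
  apply: subspace_eq_continuous => r /set_mem /=; rewrite in_itv/= => rab.
  by rewrite /from_subspace /= [x r j 0]xE// opprD addrA subrr add0r.
have cf : {within `[a, b], continuous f}.
  have -> : f = Num.sqrt \o (fun r => \sum_j ((x a j 0 - x r j 0) * (x a j 0 - x r j 0))).
    apply/funext => r; rewrite /f /norm2 /= dotE; congr Num.sqrt.
    by apply: eq_bigr => j _; rewrite !mxE.
  move=> r; apply: continuous_cvg; first exact: sqrt_continuous.
  apply: cvg_big => [|j _]; first exact: add_continuous.
  by apply: cvgM; exact: cx.
have ibound : (@lebesgue_measure R).-integrable `[a, b] (EFin \o (fun q => k * f q + L)).
  apply: continuous_compact_integrable; first exact: segment_compact.
  move=> r; apply: cvgD; last exact: cvg_cst.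
  by apply: cvgM; [exact: cvg_cst|exact: cf].
apply: (gronwall k0 ab cf) => r /andP[ar rb]; rewrite -/(f r).
have sub : [set` `[a, r]] `<=` [set` `[a, b]] by apply: subset_itvl; rewrite bnd_simp.
set I := Rintegral _ _ _.
have I0 : 0 <= I.
  by apply: Rintegral_ge0 => q _; rewrite addr_ge0// mulr_ge0 ?norm2_ge0// ltW.
rewrite /f -norm2N opprB; set w := x r - x a.
have [->|/norm2_gt0 w0] := eqVneq w 0; first by rewrite norm20.
rewrite -(ler_pM2l w0) -expr2 norm2_sqr.
have mr : measurable (`[a, r] : set (measurableTypeR R)) by [].
have ivr j : (@lebesgue_measure R).-integrable `[a, r] (fun q => (v q j 0)%:E).
  exact: integrableS (iv j).
have [idot Edot] := Rintegral_dot w mr ivr.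
have -> : dot w w = \int[@lebesgue_measure R]_(q in `[a, r]) dot w (v q).
  rewrite Edot dotE; apply: eq_bigr => j _; congr (_ * _).
  by rewrite !mxE xE ?ar// addrAC subrr add0r.
have ibr : (@lebesgue_measure R).-integrable `[a, r] (EFin \o (fun q => k * f q + L)).
  exact: integrableS ibound.
rewrite -RintegralZl//.
apply: ae_le_Rintegral => //; first exact: integrableZl ibr.
have FF : Filter (almost_everywhere (@lebesgue_measure R)).
  exact: ae_filter_ringOfSetsType.
apply: filterS vg => q vq; rewrite /= in_itv/= => /andP[aq qr].
have aqb : a <= q <= b by rewrite aq (le_trans qr).
apply: le_trans (ler_norm _) _; apply: le_trans (dot_le_norm2 _ _) _.
by rewrite ler_wpM2l ?norm2_ge0//; apply: vb => //; exact: vq.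
Qed.

(** * Motion under a held control *)

(** The control cancels [c^T A x] at the event state [xi], which leaves the
   matrix of [rho] acting on [xi]; moving from [xi] to [z] costs [A (xi - z)]. *)
Lemma held_field_decomposition (R : realType) (n : nat) (A : 'M[R]_n)
    (B c : 'cV[R]_n) (K : 'cV[R]_n -> R) (xi z : 'cV[R]_n) (dr : R) :
  A *m z + (event_control A B c K xi + dr) *: B =
  (A - (dot c B)^-1 *: (B *m (c^T *m A))) *m xi - A *m (xi - z)
  - (K xi * Num.sg (dot c xi)) *: ((dot c B)^-1 *: B) + dr *: B.
Proof.
have -> : (A - (dot c B)^-1 *: (B *m (c^T *m A))) *m xi
    = A *m xi - (dot c B)^-1 *: (dot c (A *m xi) *: B).
  rewrite mulmxBl -scalemxAl -!mulmxA [c^T *m _]mx11_scalar mul_mx_scalar.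
  by [].
rewrite mulmxBr /event_control; apply/colP => j; rewrite !mxE; ring.
Qed.

Lemma held_field_bound (R : realType) (n : nat) (A : 'M[R]_n)
    (B c : 'cV[R]_n) (K : 'cV[R]_n -> R) (xi z : 'cV[R]_n) (dr dmax : R) :
  `|dr| <= dmax ->
  norm2 (A *m z + (event_control A B c K xi + dr) *: B) <=
  opnorm2 A * norm2 (xi - z) + (rho A B c * norm2 xi + gamma B c K dmax xi).
Proof.
move=> hd; rewrite held_field_decomposition /gamma /rho.
apply: le_trans (norm2D _ _) _.
have hB : norm2 (dr *: B) <= norm2 B * dmax.
  by rewrite norm2Z mulrC ler_wpM2l ?norm2_ge0.
have hK : norm2 (- ((K xi * Num.sg (dot c xi)) *: ((dot c B)^-1 *: B)))
    <= norm2 ((dot c B)^-1 *: B) * `|K xi|.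
  rewrite norm2N norm2Z mulrC ler_wpM2l ?norm2_ge0// normrM ler_piMr//.
  by rewrite normr_sg; case: (_ == _).
have hA : norm2 (- (A *m (xi - z))) <= opnorm2 A * norm2 (xi - z).
  by rewrite norm2N norm2_mulmx.
have h1 := norm2D ((A - (dot c B)^-1 *: (B *m (c^T *m A))) *m xi) (- (A *m (xi - z))).
have h2 := norm2_mulmx (A - (dot c B)^-1 *: (B *m (c^T *m A))) xi.
have h3 := norm2D ((A - (dot c B)^-1 *: (B *m (c^T *m A))) *m xi - (A *m (xi - z)))
  (- ((K xi * Num.sg (dot c xi)) *: ((dot c B)^-1 *: B))).
lra.
Qed.

(** Any positive [k >= opnorm2 A] is allowed, so that the bound also covers
   [A = 0], where [k = opnorm2 A] would divide by zero. *)
Lemma held_deviation (R : realType) (n : nat) (A : 'M[R]_n)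
    (B c : 'cV[R]_n) (K : 'cV[R]_n -> R) (dmax ti b k : R) (d : R -> R)
    (y : R -> 'cV[R]_n) :
  0 <= dmax -> 0 < k -> opnorm2 A <= k -> ti <= b ->
  (forall r, ti <= r -> `|d r| <= dmax) ->
  filippov_solution
    (fun r z => A *m z + (event_control A B c K (y ti) + d r) *: B) ti b y ->
  norm2 (y ti - y b) <=
  (rho A B c * norm2 (y ti) + gamma B c K dmax (y ti)) / k
    * (expR (k * (b - ti)) - 1).
Proof.
move=> dmax0 k0 Ak tb hd sol.
have L0 : 0 <= rho A B c * norm2 (y ti) + gamma B c K dmax (y ti).
  by rewrite !addr_ge0 ?mulr_ge0 ?norm2_ge0 ?opnorm2_ge0.
apply: (filippov_deviation k0 L0 tb sol) => r w /andP[tr rb].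
move=> /filippov_map_affine ->.
apply: le_trans (held_field_bound _ _ _ _ _ _ (hd _ tr)) _.
by rewrite lerD2r ler_wpM2r ?norm2_ge0.
Qed.

(** * Inter-event times *)

Lemma ln_le_time (R : realType) (k L T X : R) :
  0 < k -> 0 < L -> 0 <= X -> X <= L / k * (expR (k * T) - 1) ->
  1 / k * ln (1 + X * k / L) <= T.
Proof.
move=> k0 L0 X0 XT; rewrite div1r ler_pdivrMl//.
have Y0 : 0 <= X * k / L by rewrite divr_ge0 ?mulr_ge0// ltW.
rewrite -[leRHS]expRK ler_ln ?posrE ?expR_gt0// ?ltr_pwDl//.
rewrite -lerBrDl ler_pdivrMr//.
move: XT; rewrite mulrAC ler_pdivlMr//; lra.
Qed.

Section events.
Variables (R : realType) (n : nat) (ti k L : R) (y : R -> 'cV[R]_n).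
Hypothesis k0 : 0 < k.
Hypothesis L0 : 0 < L.
Hypothesis dev : forall b, ti <= b ->
  norm2 (y ti - y b) <= L / k * (expR (k * (b - ti)) - 1).

Lemma angle_event_ge (theta : R) (N : nat) :
  0 <= sin (theta / (2 * N%:R)) ->
  ((ti + 1 / k * ln (1 + sin (theta / (2 * N%:R)) * norm2 (y ti) * k / L))%:E
    <= angle_event theta N ti y)%E.
Proof.
move=> s0; apply: le_ereal_inf_tmp => _ [r [tr yr yti hcos] <-].
rewrite lee_fin -lerBrDl ln_le_time// ?mulr_ge0 ?norm2_ge0//.
apply: le_trans (dev (ltW tr)).
by rewrite mulrC; exact: norm2_sin_le.
Qed.

Lemma error_event_ge (A : 'M[R]_n) (c : 'cV[R]_n) (sigma beta : R) :
  0 < norm2 c -> opnorm2 A <= k -> 0 <= sigma -> 0 <= beta ->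
  ((ti + 1 / k * ln (1 + (sigma * norm2 (y ti) + beta) / (norm2 c * L)))%:E
    <= error_event A c sigma beta ti y)%E.
Proof.
move=> c0 Ak s0 b0; apply: le_ereal_inf_tmp => _ [r [tr hr] <-].
rewrite lee_fin -lerBrDl.
have -> : (sigma * norm2 (y ti) + beta) / (norm2 c * L) =
    (sigma * norm2 (y ti) + beta) / (norm2 c * k) * k / L.
  by field; rewrite !gt_eqF.
have ck : 0 < norm2 c * k by rewrite mulr_gt0.
rewrite ln_le_time//.
  by rewrite divr_ge0 ?(ltW ck)// addr_ge0 ?mulr_ge0 ?norm2_ge0.
apply: le_trans (dev (ltW tr)).
rewrite ler_pdivrMr//; apply: le_trans hr _.
apply: le_trans (dot_le_norm2 _ _) _.
rewrite [leRHS]mulrC -mulrA ler_wpM2l ?norm2_ge0//.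
by apply: le_trans (norm2_mulmx _ _) _; rewrite ler_wpM2r ?norm2_ge0.
Qed.

End events.

Lemma angle_event_ge_start (R : realType) (n : nat) (theta : R) (N : nat) (ti : R)
    (y : R -> 'cV[R]_n) : (ti%:E <= angle_event theta N ti y)%E.
Proof. by apply: le_ereal_inf_tmp => _ [r [tr _ _ _] <-]; rewrite lee_fin ltW. Qed.

Lemma error_event_ge_start (R : realType) (n : nat) (A : 'M[R]_n) (c : 'cV[R]_n)
    (sigma beta ti : R) (y : R -> 'cV[R]_n) :
  (ti%:E <= error_event A c sigma beta ti y)%E.
Proof. by apply: le_ereal_inf_tmp => _ [r [tr _] <-]; rewrite lee_fin ltW. Qed.

(** No angle is defined at the origin, so the first rule stays silent. *)
Lemma angle_event_origin (R : realType) (n : nat) (theta : R) (N : nat) (ti : R)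
    (y : R -> 'cV[R]_n) : y ti = 0 -> angle_event theta N ti y = +oo%E.
Proof.
move=> y0; rewrite /angle_event y0 -[RHS](ereal_inf0 R); congr ereal_inf.
by apply/seteqP; split => // z [r [_ _ +]]; rewrite eqxx.
Qed.

(** Since [gamma = L - rho |xi|], the two fractions in the bound combine into one. *)
Lemma angle_boundE (R : realType) (n : nat) (A : 'M[R]_n) (B c : 'cV[R]_n)
    (K : 'cV[R]_n -> R) (theta : R) (N : nat) (dmax : R) (xi : 'cV[R]_n) :
  let L := rho A B c * norm2 xi + gamma B c K dmax xi in
  rho A B c != 0 -> L != 0 ->
  angle_bound A B c K theta N dmax xi =
  1 / opnorm2 A *
    ln (1 + sin (theta / (2 * N%:R)) * norm2 xi * opnorm2 A / L).
Proof.
move=> L r0 L0; rewrite /angle_bound /=; congr (_ * ln _).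
by rewrite /L; field; rewrite r0 L0.
Qed.

Lemma start_time_fin (R : realType) (n : nat) (A : 'M[R]_n)
    (B c : 'cV[R]_n) (K : 'cV[R]_n -> R) (theta : R) (N : nat)
    (sigma beta t0 : R) (d : R -> R)
    (t : nat -> \bar R) (x : R -> 'cV[R]_n) (y : nat -> R -> 'cV[R]_n) i :
  closed_loop A B c K theta N sigma beta t0 d t x y -> (t i < +oo)%E ->
  t i = (fine (t i))%:E /\ t0 <= fine (t i).
Proof.
move=> [t00 toy step] tiy.
(* events never precede the start of their interval *)
suff ti0 : (t0%:E <= t i)%E.
  have tifin : t i \is a fin_num by rewrite fin_real// tiy (lt_le_trans _ ti0) ?ltNyr.
  by rewrite fineK//; split => //; rewrite -lee_fin fineK.
elim: i {tiy} => [|i IH]; first by rewrite t00.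
have [tiy|] := ltP (t i) +oo%E; last by rewrite leye_eq => /eqP /toy ->; rewrite leey.
have [_ _ -> _] := step _ tiy.
have tifin : t i \is a fin_num by rewrite fin_real// tiy (lt_le_trans _ IH) ?ltNyr.
rewrite -(fineK tifin) in IH; rewrite le_min.
by rewrite (le_trans IH (angle_event_ge_start _ _ _ _))
  (le_trans IH (error_event_ge_start _ _ _ _ _ _)).
Qed.

Lemma mineBr (R : realType) (a b : \bar R) (r : R) :
  (mine a b - r%:E = mine (a - r%:E) (b - r%:E))%E.
Proof.
by case: (leP a b) => ab; [rewrite min_l|rewrite min_r]; rewrite // leeD2r// ltW.
Qed.

Unset Implicit Arguments.
Set Strict Implicit.
Set Printing Implicit Defensive.

Theorem theorem3p5 (R : realType) (m : nat)
    (At A P : 'M[R]_(m + 1)) (Bt B : 'cV[R]_(m + 1))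
    (hcontr : controllable At Bt)
    (hP : P \in unitmx)
    (hA : A = P *m At *m invmx P)
    (hB : P *m Bt = B)
    (hreg : B = col_mx 0 1%:M)
    (c1 chat1 ccheck1 : 'cV[R]_m) (c chat ccheck : 'cV[R]_(m + 1))
    (hc : c = col_mx c1 1%:M)
    (hchat : chat = col_mx chat1 1%:M)
    (hccheck : ccheck = col_mx ccheck1 1%:M)
    (hHc : hurwitz (ulsubmx A - ursubmx A *m c1^T))
    (hHchat : hurwitz (ulsubmx A - ursubmx A *m chat1^T))
    (hHccheck : hurwitz (ulsubmx A - ursubmx A *m ccheck1^T))
    (hside : on_either_side chat ccheck c)
    (theta : R) (htheta : theta = manifold_angle chat ccheck)
    (N : nat) (hN : (0 < N)%N)
    (sigma beta dmax : R)
    (hsigma : 0 < sigma) (hbeta : 0 < beta) (hdmax : 0 < dmax)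
    (K : 'cV[R]_(m + 1) -> R) :
  exists tau : 'cV[R]_(m + 1) -> R,
    (forall z, 0 < tau z) /\
    forall (t0 : R) (d : R -> R) (t : nat -> \bar R)
           (x : R -> 'cV[R]_(m + 1)) (y : nat -> R -> 'cV[R]_(m + 1)),
      (forall r, t0 <= r -> `|d r| <= dmax) ->
      closed_loop A B c K theta N sigma beta t0 d t x y ->
      forall i : nat, (t i < +oo)%E ->
        let ti := fine (t i) in
        let Ti1 := (angle_event theta N ti (y i) - ti%:E)%E in
        let Ti2 := (error_event A c sigma beta ti (y i) - ti%:E)%E in
        [/\ (t i.+1 - t i = mine Ti1 Ti2)%E,
            ((tau (x ti))%:E <= mine Ti1 Ti2)%E,
            ((angle_bound A B c K theta N dmax (x ti))%:E <= Ti1)%E &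
            ((error_bound A B c K sigma beta dmax (x ti))%:E <= Ti2)%E].
Proof.
have last_neq0 (a : 'cV[R]_m) : (col_mx a 1%:M : 'cV[R]_(m + 1)) != 0.
  apply/eqP => /colP/(_ (rshift m 0)); rewrite col_mxEd !mxE eqxx => /eqP.
  by rewrite oner_eq0.
have B0 : 0 < norm2 B by rewrite norm2_gt0// hreg last_neq0.
have c0 : 0 < norm2 c by rewrite norm2_gt0// hc last_neq0.
pose s := sin (theta / (2 * N%:R)).
have s0 : 0 < s.
  have := manifold_angle_bounds chat1 ccheck1.
  rewrite -hchat -hccheck -htheta => /andP[th0 thpi].
  have N0 : 1 <= N%:R :> R by rewrite ler1n.
  have N2 : 0 < 2 * N%:R :> R by lra.
  apply: sin_gt0_pi; rewrite divr_gt0//= ltr_pdivrMr//.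
  by rewrite (le_lt_trans thpi)// ltr_pMr ?pi_gt0//; lra.
pose L z := rho A B c * norm2 z + gamma B c K dmax z.
have L0 z : 0 < L z.
  rewrite ltr_wpDl ?mulr_ge0 ?norm2_ge0 ?opnorm2_ge0//.
  by rewrite ltr_wpDl ?mulr_ge0 ?norm2_ge0// mulr_gt0.
pose k := opnorm2 A + 1.
have k0 : 0 < k by rewrite ltr_wpDl// opnorm2_ge0.
have Ak : opnorm2 A <= k by rewrite lerDl.
pose tau1 z := 1 / k * ln (1 + s * norm2 z * k / L z).
pose tau2 z := 1 / k * ln (1 + (sigma * norm2 z + beta) / (norm2 c * L z)).
have tau20 z : 0 < tau2 z.
  rewrite mulr_gt0 ?divr_gt0// ln_gt0// ltrDl divr_gt0 ?mulr_gt0//.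
  by rewrite ltr_wpDl// mulr_ge0 ?norm2_ge0// ltW.
pose tau (z : 'cV[R]_(m + 1)) := if z == 0 then tau2 z else Num.min (tau1 z) (tau2 z).
exists tau; split.
  move=> z; rewrite /tau; case: eqVneq => // /norm2_gt0 z0; rewrite lt_min tau20 andbT.
  by rewrite mulr_gt0 ?divr_gt0// ln_gt0// ltrDl divr_gt0 ?mulr_gt0.
move=> t0 d t x y hd loop i tiy ti Ti1 Ti2.
have [tiE t0ti] := start_time_fin loop tiy.
have [_ _ /(_ i tiy)] := loop; rewrite -/ti => -[yx sol tS _].
have dev k' : 0 < k' -> opnorm2 A <= k' -> forall b, ti <= b ->
    norm2 (y i ti - y i b) <= L (y i ti) / k' * (expR (k' * (b - ti)) - 1).
  move=> k'0 Ak' b tb; apply: (@held_deviation _ _ A B c K dmax _ _ _ d) => //.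
  - exact: ltW.
  - by move=> r tr; rewrite hd// (le_trans t0ti).
  - by rewrite yx; exact: sol.
rewrite -yx.
have A0 := opnorm2_ge0 A.
have start1 : (0 <= Ti1)%E by rewrite leeBrDr// add0e angle_event_ge_start.
have start2 : (0 <= Ti2)%E by rewrite leeBrDr// add0e error_event_ge_start.
split.
- by rewrite tS tiE mineBr.
- have h2 : ((tau2 (y i ti))%:E <= Ti2)%E.
    rewrite leeBrDr// -EFinD addrC.
    by apply: error_event_ge => //; [exact: dev|exact: ltW|exact: ltW].
  rewrite /tau; case: eqVneq => [y0|_]; rewrite le_min.
    by rewrite h2 andbT /Ti1 angle_event_origin// leey.
  have h1 : ((tau1 (y i ti))%:E <= Ti1)%E.
    rewrite leeBrDr// -EFinD addrC.
    by apply: angle_event_ge => //; [exact: dev|exact: ltW].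
  by rewrite (le_trans _ h1) ?(le_trans _ h2)// lee_fin ge_min lexx ?orbT.
- (* division by zero gives [0] when the norm of [A] is zero *)
  have [A00|An0] := eqVneq (opnorm2 A) 0.
    by rewrite /angle_bound A00 invr0 mulr0 mul0r.
  (* division by zero gives [ln 1] when [rho = 0] *)
  have [r0|rn0] := eqVneq (rho A B c) 0.
    by rewrite /angle_bound r0 invr0 !(mulr0, mul0r) addr0 subr0 ln1 mulr0.
  have Agt : 0 < opnorm2 A by rewrite lt_def An0.
  rewrite angle_boundE//; last by rewrite gt_eqF// L0.
  rewrite leeBrDr// -EFinD addrC.
  by apply: angle_event_ge => //; [exact: L0|exact: dev|exact: ltW].
- have [A00|An0] := eqVneq (opnorm2 A) 0.
    by rewrite /error_bound A00 invr0 mulr0 mul0r.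
  have Agt : 0 < opnorm2 A by rewrite lt_def An0.
  rewrite leeBrDr// -EFinD addrC.
  by apply: error_event_ge => //; [exact: L0|exact: dev|exact: ltW|exact: ltW].
Qed.
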